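(* Let $A\in\mathbb{C}^{n\times n}$, let $\widehat V\in\mathbb{C}^{n\times n}$ be invertible, let $\widehat W\in\mathbb{C}^{n\times n}$ be arbitrary, and let $\widehat D\in\mathbb{C}^{n\times n}$ be diagonal. Define $$R:=A\widehat V-\widehat V\widehat D,\qquad \Delta:=\widehat W^{\mathrm H}\widehat V-I,\qquad Y_\star:=\widehat V^{-1}R,\qquad Y_W:=\widehat W^{\mathrm H}R.$$ Then $$Y_W-Y_\star=\Delta Y_\star$$ holds exactly. Hence, for any subordinate matrix norm $\|\cdot\|$, $$\|Y_W-Y_\star\|\le\|\Delta\|\,\|Y_\star\|.$$
   Context: The superscript $\mathrm H$ denotes the conjugate transpose. A subordinate matrix norm is an operator norm on $\mathbb{C}^{n\times n}$ induced by a vector norm on $\mathbb{C}^n$. *)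

(* Defs.v *)
From mathcomp Require Export all_boot all_order all_algebra.
From mathcomp Require Export complex.
From mathcomp Require Export classical_sets reals.

Set Implicit Arguments.
Unset Strict Implicit.
Unset Printing Implicit Defensive.

Import Order.TTheory GRing.Theory Num.Theory.

Local Open Scope classical_set_scope.
Local Open Scope ring_scope.

(* [Normc.normc c : R] is the modulus of [c]; the library's [`|c|] is the same
   number seen in [R[i]]. *)
Record vector_norm (R : realType) (n : nat) (N : 'cV[R[i]]_n -> R) : Prop :=
  VectorNorm {
    vector_norm_ge0 : forall v, 0 <= N v;
    vector_norm_eq0 : forall v, N v = 0 -> v = 0;
    vector_normZ : forall c v, N (c *: v) = Normc.normc c * N v;
    vector_normD : forall u v, N (u + v) <= N u + N v }.

(* [sup] defaults to 0 on sets without a supremum; for a vector norm [N] the set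
   below is bounded (finite dimension), and it is empty only when [n = 0]. *)
Definition operator_norm (R : realType) (n : nat) (N : 'cV[R[i]]_n -> R)
    (M : 'M[R[i]]_n) : R :=
  sup [set N (M *m v) / N v | v in [set v | v != 0]].

Definition subordinate_norm (R : realType) (n : nat) (nu : 'M[R[i]]_n -> R) :
    Prop :=
  exists2 N, vector_norm N & forall M, nu M = operator_norm N M.

(* Main.v *)
Require Import Defs.
From mathcomp Require Import boolp topology normedtype derive.
Import Order.TTheory GRing.Theory Num.Theory.
Import numFieldNormedType.Exports.

Set Implicit Arguments.
Unset Strict Implicit.
Unset Printing Implicit Defensive.

(** Since [V] is invertible, [Res = V Ystar], so [W^H Res - Ystar] is
    [(W^H V - I) Ystar] by associativity and distributivity alone.

    The norm bound is then submultiplicativity of an operator norm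
    ([operator_normM]), which follows from [N (M v) <= operator_norm N M * N v]
    ([operator_norm_bound]).  This last inequality has content here: the operator
    norm is a supremum that collapses to 0 on an unbounded set, so one must know
    that [N (M v) / N v] is bounded, which is where finite dimension enters.

    Boundedness is an instance of the principle that every seminorm on [C^n] is
    dominated by every norm ([seminorm_le_vector_norm]), applied to the seminorm
    [v |-> N (M v)].  Both are compared with the sup norm of the [2 n] real
    coordinates of [v].  A seminorm is at most a multiple of the sup norm, by
    expansion on the canonical basis ([seminorm_le_coord]), hence it is
    continuous; a norm, being continuous and positive on the compact unit
    sphere, is at least a positive multiple of the sup norm
    ([vector_norm_ge_coord]). *)

Local Open Scope classical_set_scope.
Local Open Scope ring_scope.
Local Open Scope sesquilinear_scope.

Definition seminorm (R : realType) (n : nat) (p : 'cV[R[i]]_n -> R) : Prop :=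
  (forall c v, p (c *: v) = Normc.normc c * p v) /\
  (forall u v, p (u + v) <= p u + p v).

(** Real coordinates make the Heine-Borel theorem for real row vectors usable on
    [C^n]: the first [n] entries are the real parts, the last [n] the imaginary
    parts. *)
Definition complex_col (R : realType) (n : nat) (x : 'rV[R]_(n + n)) :
    'cV[R[i]]_n :=
  \col_i (x 0 (lshift n i) +i* x 0 (rshift n i))%C.

Section ComplexCoordinates.
Variables (R : realType) (n : nat).
Implicit Types (x y : 'rV[R]_(n + n)) (v : 'cV[R[i]]_n).

Lemma complex_colB x y : complex_col (x - y) = complex_col x - complex_col y.
Proof. by apply/colP => i; rewrite !mxE. Qed.

Lemma complex_colZ (t : R) x : complex_col (t *: x) = t%:C%C *: complex_col x.
Proof.
by apply/colP => i; rewrite !mxE; apply/eqP; rewrite eq_complex /= !mul0r subr0 addr0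
  !eqxx.
Qed.

Lemma complex_col_surj v : exists x, v = complex_col x.
Proof.
exists (row_mx (\row_i complex.Re (v i 0)) (\row_i complex.Im (v i 0))).
apply/colP => i; rewrite !mxE (unsplitK (inl i)) (unsplitK (inr i)) !mxE.
by case: (v i 0).
Qed.

Lemma complex_col_eq0 x : complex_col x = 0 -> x = 0.
Proof.
move=> /colP x0; apply/rowP => j; rewrite mxE -(splitK j).
by case: (split j) => i /=; have := x0 i; rewrite !mxE => -[].
Qed.

End ComplexCoordinates.

Lemma normc_complex_col (R : realType) n (x : 'rV[R]_(n + n)) i :
  Normc.normc (complex_col x i 0) <= 2 * `|x|.
Proof.
have coord j : `|x 0 j| <= `|x|.
  rewrite [leRHS]/Num.Def.normr /= mx_normrE.
  exact: (le_bigmax _ (fun ij => `|x ij.1 ij.2|) (0, j)).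
have -> : complex_col x i 0 =
    (x 0 (lshift n i))%:C%C + (0 +i* x 0 (rshift n i))%C.
  by rewrite mxE; apply/eqP; rewrite eq_complex /= addr0 add0r !eqxx.
apply: le_trans (le_normcD _ _) _.
rewrite /Normc.normc /= expr0n /= addr0 add0r !sqrtr_sqr mulr_natl mulr2n.
exact: lerD.
Qed.

Section Seminorm.
Variables (R : realType) (n : nat) (p : 'cV[R[i]]_n -> R).
Hypothesis p_seminorm : seminorm p.

Lemma seminorm0 : p 0 = 0.
Proof. by rewrite -(scale0r 0) p_seminorm.1 Normc.normc0 mul0r. Qed.

Lemma seminormN v : p (- v) = p v.
Proof. by rewrite -scaleN1r p_seminorm.1 normcN Normc.normc1 mul1r. Qed.

Lemma seminorm_ge0 v : 0 <= p v.
Proof.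
have := p_seminorm.2 v (- v); rewrite subrr seminorm0 seminormN.
by rewrite -mulr2n pmulrn_lge0.
Qed.

Lemma seminorm_dist u v : `|p u - p v| <= p (u - v).
Proof.
rewrite ler_norml lerBlDr lerNl opprB lerBlDr.
have := p_seminorm.2 (u - v) v; rewrite subrK => ->; rewrite andbT.
by have := p_seminorm.2 (v - u) u; rewrite subrK -opprB seminormN.
Qed.

(** Triangle inequality on the expansion [v = \sum_i v_i e_i]. *)
Lemma seminorm_le_coord :
  exists2 C, 0 <= C & forall x, p (complex_col x) <= C * `|x|.
Proof.
exists (2 * \sum_i p (delta_mx i 0)).
  by rewrite mulr_ge0 ?sumr_ge0 // => i _; exact: seminorm_ge0.
move=> x; rewrite [complex_col x]matrix_sum_delta.
apply: (@le_trans _ _ (\sum_i p (complex_col x i 0 *: delta_mx i 0))).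
  elim/big_ind2: _ => [|u a w b ua wb|i _]; first by rewrite seminorm0.
    exact: le_trans (p_seminorm.2 _ _) (lerD ua wb).
  by rewrite big_ord1.
rewrite mulrAC mulr_sumr; apply: ler_sum => i _.
rewrite p_seminorm.1 ler_wpM2r ?seminorm_ge0 //; exact: normc_complex_col.
Qed.

(** A seminorm is Lipschitz: [|p u - p v| <= p (u - v) <= C |u - v|], the
    last norm being the sup norm of the real coordinates. *)
Lemma seminorm_continuous : continuous (fun x : 'rV[R]_(n + n) => p (complex_col x)).
Proof.
have [C C0 pC] := seminorm_le_coord.
move=> x; apply/(@cvgrPdist_lt _ _ _ _ (nbhs_filter x)) => e e0.
(* [C] may be 0, so [C + 1] serves as the Lipschitz constant one divides by. *)
have C1 : 0 < C + 1 by rewrite ltr_wpDl.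
near=> y.
apply: le_lt_trans (seminorm_dist _ _) _; rewrite -complex_colB.
apply: le_lt_trans (pC _) _.
apply: (@le_lt_trans _ _ ((C + 1) * `|x - y|)).
  by rewrite ler_wpM2r // lerDl.
rewrite mulrC -ltr_pdivlMr //.
near: y.
exact: (@cvgr_dist_lt _ _ _ _ (nbhs_filter x) id x cvg_id _ (divr_gt0 e0 C1)).
Unshelve. all: by end_near. Qed.

End Seminorm.

Lemma vector_norm_seminorm (R : realType) n (N : 'cV[R[i]]_n -> R) :
  vector_norm N -> seminorm N.
Proof. by case. Qed.

Lemma seminorm_mulmx (R : realType) m n (p : 'cV[R[i]]_m -> R)
    (M : 'M[R[i]]_(m, n)) :
  seminorm p -> seminorm (fun v => p (M *m v)).
Proof.
by move=> [pZ pD]; split=> [c v|u v]; rewrite -?scalemxAr ?pZ ?mulmxDr.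
Qed.

(** The constant is the minimum of [N] on the unit sphere of the sup norm, which
    is positive because [N] only vanishes at 0; homogeneity extends the bound from
    the sphere to the whole space. *)
Lemma vector_norm_ge_coord (R : realType) n (N : 'cV[R[i]]_n -> R) :
  vector_norm N ->
  exists2 m, 0 < m & forall x, m * `|x| <= N (complex_col x).
Proof.
move=> Nnorm; have Nsemi := vector_norm_seminorm Nnorm.
pose S := [set x : 'rV[R]_(n + n) | `|x| = 1].
have S_unit x : x != 0 -> S (`|x|^-1 *: x).
  by move=> x0; rewrite /S /= normrZ normfV normr_id mulVf // normr_eq0.
have [S0|/set0P/negP/negPn/eqP S0] := pselect (S !=set0); last first.
  (* An empty sphere means [n = 0]: the only vector is 0. *)
  exists 1 => // x; have [->|/S_unit] := eqVneq x 0; last by rewrite S0.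
  by rewrite normr0 mulr0 (vector_norm_ge0 Nnorm).
have S_compact : compact S.
  apply: bounded_closed_compact.
    by exists 1; split=> // y y1 x /= ->; exact: ltW.
  apply: (preimage_closed (f := fun x : 'rV[R]_(n + n) => `|x|) (D := [set 1])) => //.
  by move=> x _; exact: norm_continuous.
have [c cS cmin] := compact_EVT_min S0 S_compact
  (continuous_subspaceT (seminorm_continuous Nsemi)).
have c1 : `|c| = 1 by move: cS; rewrite inE.
exists (N (complex_col c)).
  rewrite lt_def (vector_norm_ge0 Nnorm) andbT; apply/eqP.
  move=> /(vector_norm_eq0 Nnorm) /complex_col_eq0 c0.
  by move/eqP: c1; rewrite c0 normr0 eq_sym oner_eq0.
move=> x; have [->|x0] := eqVneq x 0.
  by rewrite normr0 mulr0 (vector_norm_ge0 Nnorm).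
have /= := cmin _ (mem_set (S_unit _ x0)).
rewrite complex_colZ (vector_normZ Nnorm) /Normc.normc /= expr0n addr0 sqrtr_sqr.
by rewrite normfV normr_id mulrC ler_pdivlMr // normr_gt0.
Qed.

(** Half of the equivalence of norms in finite dimension.  Allowing a seminorm on
    the left covers [v |-> N (M v)] for a singular matrix [M]. *)
Lemma seminorm_le_vector_norm (R : realType) n (p N : 'cV[R[i]]_n -> R) :
  seminorm p -> vector_norm N -> exists K, forall v, p v <= K * N v.
Proof.
move=> /seminorm_le_coord [C C0 pC] /vector_norm_ge_coord [m m0 mN].
exists (C / m) => v; have [x ->] := complex_col_surj v.
apply: le_trans (pC x) _; rewrite -mulrA ler_wpM2l //.
by rewrite mulrC ler_pdivlMr // mulrC.
Qed.

Section OperatorNorm.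
Variables (R : realType) (n : nat) (N : 'cV[R[i]]_n -> R).
Hypothesis N_norm : vector_norm N.

Lemma vector_norm_gt0 v : v != 0 -> 0 < N v.
Proof.
move=> v0; rewrite lt_def (vector_norm_ge0 N_norm) andbT.
by apply: contra v0 => /eqP /(vector_norm_eq0 N_norm) ->.
Qed.

(** The supremum is an upper bound only because the quotients [N (M v) / N v] are
    bounded, [v |-> N (M v)] being a seminorm, hence dominated by [N]. *)
Lemma operator_norm_bound (M : 'M[R[i]]_n) v :
  N (M *m v) <= operator_norm N M * N v.
Proof.
have Nsemi := vector_norm_seminorm N_norm.
have [->|v0] := eqVneq v 0; first by rewrite mulmx0 (seminorm0 Nsemi) mulr0.
rewrite -ler_pdivrMr ?vector_norm_gt0 //.
have [K NK] := seminorm_le_vector_norm (seminorm_mulmx M Nsemi) N_norm.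
apply: ub_le_sup; last by exists v.
by exists K => _ [u u0 <-]; rewrite ler_pdivrMr ?vector_norm_gt0 // NK.
Qed.

Lemma operator_norm_ge0 (M : 'M[R[i]]_n) : 0 <= operator_norm N M.
Proof.
have [[v v0]|no_v] := pselect (exists v : 'cV[R[i]]_n, v != 0).
  rewrite -(pmulr_lge0 _ (vector_norm_gt0 v0)).
  exact: le_trans (vector_norm_ge0 N_norm _) (operator_norm_bound M v).
rewrite /operator_norm (_ : [set _ | _ in _] = set0) ?sup0 //.
by rewrite -subset0 => t [v v0 _]; apply: no_v; exists v.
Qed.

Lemma operator_normM (P Q : 'M[R[i]]_n) :
  operator_norm N (P *m Q) <= operator_norm N P * operator_norm N Q.
Proof.
rewrite [leLHS]/operator_norm.
(* For [n = 0] the left-hand side is the supremum of the empty set, which is 0. *)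
set E := (X in sup X); have [E0|/set0P/negP/negPn/eqP->] := pselect (E !=set0);
  last by rewrite sup0 mulr_ge0 ?operator_norm_ge0.
apply: ge_sup => // _ [v v0 <-].
rewrite ler_pdivrMr ?vector_norm_gt0 // -mulmxA.
apply: le_trans (operator_norm_bound _ _) _.
by rewrite -mulrA ler_wpM2l ?operator_norm_ge0 ?operator_norm_bound.
Qed.

End OperatorNorm.

Theorem proposition2 (R : realType) (n : nat) (A V W D : 'M[R[i]]_n)
    (V_inv : V \in unitmx) (D_diag : is_diag_mx D) :
  let Res := A *m V - V *m D in
  let Delta := W ^t* *m V - 1%:M in
  let Ystar := invmx V *m Res in
  let YW := W ^t* *m Res in
  YW - Ystar = Delta *m Ystar /\
  (forall nu : 'M[R[i]]_n -> R, subordinate_norm nu ->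
     nu (YW - Ystar) <= nu Delta * nu Ystar).
Proof.
move=> Res Delta Ystar YW.
have YE : YW - Ystar = Delta *m Ystar.
  by rewrite /Delta mulmxBl mul1mx -mulmxA mulKVmx.
split=> // nu [N N_norm nuE].
by rewrite YE !nuE; exact: operator_normM.
Qed.
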